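(* Let $T=U-V$ be a proper splitting of $T\in M^{m\times n}(\mathbb{C})$ and let $W\in M^{m\times r}(\mathbb{C})$ be such that $\mathcal{R}(W)\subseteq\mathcal{R}(T)$. For each subspace $\mathcal{M}$ with $\mathcal{M}\overset{.}{+}\mathcal{N}(T)=\mathbb{C}^n$, consider the iterative process for $\mathcal{M}$ of the proper splitting $T=U-V$ with respect to $W$, $$X^{i+1}=Y_{\mathcal{M}}X^{i}+Z_{\mathcal{M}},$$ where $Y_{\mathcal{M}}\in M^n(\mathbb{C})$ and $Z_{\mathcal{M}}\in M^{n\times r}(\mathbb{C})$ are the reduced solutions for $\mathcal{M}$ of $UY=V$ and $UZ=W$, respectively. Then the iterative process converges (for all initial $X^0\in M^{n\times r}(\mathbb{C})$) for some $\mathcal{M}$ with $\mathcal{M}\overset{.}{+}\mathcal{N}(T)=\mathbb{C}^n$ if and only if it converges (for all initial $X^0$) for every $\mathcal{M}$ with $\mathcal{M}\overset{.}{+}\mathcal{N}(T)=\mathbb{C}^n$. In particular, the iterative process (for any such $\mathcal{M}$) is convergent for all initial $X^0$ if and only if $\rho(U^\dagger V)<1$.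
   Context: $M^{m\times n}(\mathbb{C})$ denotes the complex $m\times n$ matrices and $M^n(\mathbb{C})=M^{n\times n}(\mathbb{C})$; $\mathcal{R}(\cdot)$, $\mathcal{N}(\cdot)$, $\rho(\cdot)$ denote range, nullspace and spectral radius; $\overset{.}{+}$ denotes direct sum of subspaces; $U^\dagger$ is the Moore-Penrose inverse. Proper splitting: a decomposition $T=U-V$ with $U,V\in M^{m\times n}(\mathbb{C})$ is a proper splitting of $T\in M^{m\times n}(\mathbb{C})$ if $\mathcal{R}(U)=\mathcal{R}(T)$ and $\mathcal{N}(U)=\mathcal{N}(T)$. In that case $\mathcal{R}(V)\subseteq\mathcal{R}(T)$ and $\mathcal{N}(T)\subseteq\mathcal{N}(V)$. Reduced solution: if $A\in M^{m\times n}(\mathbb{C})$, $B\in M^{m\times r}(\mathbb{C})$, $\mathcal{R}(B)\subseteq\mathcal{R}(A)$ and $\mathcal{M}\overset{.}{+}\mathcal{N}(A)=\mathbb{C}^n$, there is a unique $X_{\mathcal{M}}\in M^{n\times r}(\mathbb{C})$ with $AX_{\mathcal{M}}=B$ and $\mathcal{R}(X_{\mathcal{M}})\subseteq\mathcal{M}$; it is called the reduced solution for $\mathcal{M}$ of $AX=B$. *)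

(* Defs.v *)
From mathcomp Require Import all_boot all_order all_algebra.
From mathcomp Require Import all_classical all_reals all_analysis.
From mathcomp Require Import complex.

Set Implicit Arguments.
Unset Strict Implicit.
Unset Printing Implicit Defensive.

Import Order.TTheory GRing.Theory Num.Theory.
Import numFieldNormedType.Exports.
Local Open Scope classical_set_scope.
Local Open Scope ring_scope.
Local Open Scope sesquilinear_scope.

(* Naming the numClosedFieldType structure of R[i] is what lets the topology
   that MathComp-Analysis puts on every numFieldType (hence on matrices over
   it) be inferred. *)
Definition Cplx (R : realType) : numClosedFieldType := R[i].

(* Matrices act on column vectors, so these are the range and the nullspace in
   the usual sense, not MathComp's row space and row kernel. *)
Definition mxfun (C : fieldType) (m n : nat) (A : 'M[C]_(m, n)) :
  'Hom('cV[C]_n, 'cV[C]_m) := linfun (mulmx A).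

Definition mxrange (C : fieldType) (m n : nat) (A : 'M[C]_(m, n)) :
  {vspace 'cV[C]_m} := limg (mxfun A).

Definition mxnull (C : fieldType) (m n : nat) (A : 'M[C]_(m, n)) :
  {vspace 'cV[C]_n} := lker (mxfun A).

Definition complementary (C : fieldType) (n : nat)
    (M N : {vspace 'cV[C]_n}) : Prop :=
  directv (M + N) /\ (M + N)%VS = fullv.

Definition proper_splitting (C : fieldType) (m n : nat)
    (T U V : 'M[C]_(m, n)) : Prop :=
  [/\ T = U - V, mxrange U = mxrange T & mxnull U = mxnull T].

Definition is_reduced_solution (C : fieldType) (m n r : nat)
    (M : {vspace 'cV[C]_n}) (A : 'M[C]_(m, n)) (B : 'M[C]_(m, r))
    (X : 'M[C]_(n, r)) : Prop :=
  A *m X = B /\ (mxrange X <= M)%VS.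

(* The value is 0 when there is no reduced solution; see
   reduced_solutionP and reduced_solution_unique. *)
Definition reduced_solution (C : fieldType) (m n r : nat)
    (M : {vspace 'cV[C]_n}) (A : 'M[C]_(m, n)) (B : 'M[C]_(m, r)) :
    'M[C]_(n, r) :=
  xget 0 [set X | is_reduced_solution M A B X].

Definition is_mp_inverse (C : numClosedFieldType) (m n : nat)
    (A : 'M[C]_(m, n)) (P : 'M[C]_(n, m)) : Prop :=
  [/\ A *m P *m A = A, P *m A *m P = P,
      (A *m P) ^t* = A *m P & (P *m A) ^t* = P *m A].

(* The Moore-Penrose inverse, which MathComp's pinvmx is not: it is the
   unique solution of the Penrose equations, by mp_inverseP and mp_inverse_unique. *)
Definition mp_inverse (C : numClosedFieldType) (m n : nat) (A : 'M[C]_(m, n)) :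
  'M[C]_(n, m) := xget 0 [set P | is_mp_inverse A P].

(* The modulus `|a| is an element of R[i], hence the real part.  For n = 0 the
   set is empty and the value is 0. *)
Definition spectral_radius (R : realType) (n : nat) (A : 'M[Cplx R]_n) : R :=
  sup [set complex.Re `|a| | a in [set a : Cplx R | eigenvalue A a]].

Definition iterates (R : realType) (m n r : nat)
    (U V : 'M[Cplx R]_(m, n)) (W : 'M[Cplx R]_(m, r))
    (M : {vspace 'cV[Cplx R]_n}) (X0 : 'M[Cplx R]_(n, r)) (i : nat) :
    'M[Cplx R]_(n, r) :=
  iter i (fun X => reduced_solution M U V *m X + reduced_solution M U W) X0.

Section Reduced.
Variables (C : fieldType).

Lemma mxfunE (m n : nat) (A : 'M[C]_(m, n)) (x : 'cV_n) :
  mxfun A x = A *m x.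
Proof. by rewrite lfunE. Qed.

Lemma colM (m n r : nat) (A : 'M[C]_(m, n)) (B : 'M[C]_(n, r)) j :
  col j (A *m B) = A *m col j B.
Proof. by rewrite !colE mulmxA. Qed.

Lemma mem_mxnull (m n : nat) (A : 'M[C]_(m, n)) (x : 'cV_n) :
  (x \in mxnull A) = (A *m x == 0).
Proof. by rewrite memv_ker mxfunE. Qed.

Lemma mxrangeP (m n : nat) (A : 'M[C]_(m, n)) (y : 'cV_m) :
  reflect (exists x, y = A *m x) (y \in mxrange A).
Proof.
apply: (iffP memv_imgP) => [[x _ ->]|[x ->]]; exists x.
- by rewrite mxfunE.
- exact: memvf.
- by rewrite mxfunE.
Qed.

Lemma mxrange_sub (m n : nat) (A : 'M[C]_(m, n)) (M : {vspace 'cV[C]_m}) :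
  (mxrange A <= M)%VS <-> forall j, col j A \in M.
Proof.
split=> [/subvP sAM j | AM].
  by apply: sAM; apply/mxrangeP; exists (col j 1%:M); rewrite -colM mulmx1.
apply/subvP => _ /mxrangeP [x ->].
suff -> : A *m x = \sum_j x j 0 *: col j A.
  by apply: memv_suml => j _; apply: memvZ.
apply/colP=> i; rewrite mxE summxE; apply: eq_bigr => j _.
by rewrite !mxE mulrC.
Qed.

Lemma reduced_solutionP (m n r : nat) (M : {vspace 'cV[C]_n})
    (A : 'M[C]_(m, n)) (B : 'M[C]_(m, r)) :
  (mxrange B <= mxrange A)%VS -> complementary M (mxnull A) ->
  is_reduced_solution M A B (reduced_solution M A B).
Proof.
move=> sBA [/directv_addP dMN fMN].
rewrite /reduced_solution; case: xgetP => // noX; exfalso.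
have sol j : exists x, (x \in M) && (A *m x == col j B).
  have /mxrange_sub/(_ j)/mxrangeP [v Bv] := sBA.
  exists (daddv_pi M (mxnull A) v); rewrite memv_pi /= Bv.
  have /eqP {2}<- : daddv_pi M (mxnull A) v + daddv_pi (mxnull A) M v == v.
    by rewrite daddv_pi_add // fMN memvf.
  rewrite mulmxDr.
  have: daddv_pi (mxnull A) M v \in mxnull A by rewrite memv_pi.
  by rewrite mem_mxnull => /eqP ->; rewrite addr0.
pose x j := xchoose (sol j).
have colx j : col j (\matrix_(i, j) x j i 0) = x j.
  by apply/colP=> i; rewrite !mxE.
apply: (noX (\matrix_(i, j) x j i 0)); split.
  apply/matrixP => i j.
  have /andP[_ /eqP/colP/(_ i)] := xchooseP (sol j).
  rewrite [col j B i 0]mxE => <-; rewrite !mxE; apply: eq_bigr => k _.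
  by rewrite !mxE.
by apply/mxrange_sub => j; rewrite colx; have /andP[] := xchooseP (sol j).
Qed.

Lemma reduced_solution_unique (m n r : nat) (M : {vspace 'cV[C]_n})
    (A : 'M[C]_(m, n)) (B : 'M[C]_(m, r)) (X : 'M[C]_(n, r)) :
  (mxrange B <= mxrange A)%VS -> complementary M (mxnull A) ->
  is_reduced_solution M A B X -> X = reduced_solution M A B.
Proof.
move=> sBA cMA [AX XM]; have [AY YM] := reduced_solutionP sBA cMA.
have [/directv_addP dMN _] := cMA; set Y := reduced_solution M A B in AY YM *.
have XYj j : col j X = col j Y.
  apply/eqP; rewrite -subr_eq0 -memv0 -dMN memv_cap; apply/andP; split.
    by apply: rpredB; [move/mxrange_sub: XM | move/mxrange_sub: YM]; apply.
  by rewrite mem_mxnull mulmxBr -!colM AX AY subrr.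
by apply/matrixP=> i j; have /colP/(_ i) := XYj j; rewrite !mxE.
Qed.

End Reduced.

Section MoorePenrose.
Variables (C : numClosedFieldType).

Lemma trmxCM (m n p : nat) (A : 'M[C]_(m, n)) (B : 'M[C]_(n, p)) :
  (A *m B) ^t* = B ^t* *m A ^t*.
Proof. by rewrite trmx_mul map_mxM. Qed.

Lemma trmxC_inv (n : nat) (A : 'M[C]_n) : (invmx A) ^t* = invmx (A ^t*).
Proof. by rewrite trmx_inv map_invmx. Qed.

Lemma gram_unit (m n : nat) (A : 'M[C]_(m, n)) :
  row_free A -> A *m A ^t* \in unitmx.
Proof.
move=> fA; rewrite -row_free_unit -kermx_eq0; apply/eqP/row_matrixP => i.
rewrite row0; set u := row i _.
have uAA : u *m A *m A ^t* = 0.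
  by rewrite -mulmxA; apply/sub_kermxP/row_sub.
have: ((u *m A) *m (u *m A) ^t*) 0 0 = 0.
  by rewrite trmxCM mulmxA uAA mul0mx mxE.
rewrite mxE => /eqP; rewrite psumr_eq0 => [/allP uA0|j _]; last first.
  by rewrite !mxE mul_conjC_ge0.
apply: (row_free_inj fA); rewrite mul0mx; apply/rowP=> j.
have /= := uA0 j (mem_index_enum j).
rewrite [((u *m A) ^t*) j 0]mxE [((u *m A)^T) j 0]mxE mul_conjC_eq0.
by move=> /eqP ->; rewrite mxE.
Qed.

Lemma full_rank_mp_inverse (m k n : nat) (F : 'M[C]_(m, k)) (G : 'M[C]_(k, n)) :
  row_full F -> row_free G ->
  is_mp_inverse (F *m G) (G ^t* *m invmx (G *m G ^t*)
                    *m invmx (F ^t* *m F) *m F ^t*).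
Proof.
move=> fF fG.
have GGu : G *m G ^t* \in unitmx by exact: gram_unit.
have FFu : F ^t* *m F \in unitmx.
  rewrite -{2}[F]trmxCK; apply: gram_unit.
  by rewrite /row_free mxrank_map mxrank_tr; exact: fF.
have GGs : (G *m G ^t*) ^t* = G *m G ^t* by rewrite trmxCM trmxCK.
have FFs : (F ^t* *m F) ^t* = F ^t* *m F by rewrite trmxCM trmxCK.
pose A := F *m G; pose g := invmx (G *m G ^t*); pose f := invmx (F ^t* *m F).
pose P := G ^t* *m g *m f *m F ^t*.
have AP : A *m P = F *m f *m F ^t*.
  by rewrite /P !mulmxA -(mulmxA F G) mulmxK.
have PA : P *m A = G ^t* *m g *m G.
  by rewrite /P /A !mulmxA -!(mulmxA _ (F ^t*) F) mulmxKV.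
rewrite -/A -/g -/f -/P; split.
- by rewrite AP /A !mulmxA -!(mulmxA _ (F ^t*) F) mulmxKV.
- by rewrite PA /P !mulmxA -!(mulmxA _ G (G ^t*)) mulmxKV.
- by rewrite AP !trmxCM trmxCK trmxC_inv FFs mulmxA.
- by rewrite PA !trmxCM trmxCK trmxC_inv GGs mulmxA.
Qed.

Lemma mp_inverseP (m n : nat) (A : 'M[C]_(m, n)) : is_mp_inverse A (mp_inverse A).
Proof.
rewrite /mp_inverse; case: xgetP => // noP; exfalso.
have := full_rank_mp_inverse (col_base_full A) (row_base_free A).
by rewrite mulmx_base => /noP.
Qed.

Lemma mp_inverse_unique (m n : nat) (A : 'M[C]_(m, n)) (P : 'M[C]_(n, m)) :
  is_mp_inverse A P -> P = mp_inverse A.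
Proof.
case=> APA PAP sAP sPA; have [AQA QAQ sAQ sQA] := mp_inverseP A.
set Q := mp_inverse A in AQA QAQ sAQ sQA *.
have APQ : A *m P = A *m Q.
  by rewrite -{1}AQA -mulmxA -sAP -{1}sAQ -trmxCM mulmxA APA sAQ.
have PQA : P *m A = Q *m A.
  rewrite -{1}AQA -(mulmxA A) mulmxA -sPA -{1}sQA -trmxCM -mulmxA (mulmxA A).
  by rewrite APA sQA.
by rewrite -PAP PQA -mulmxA APQ mulmxA QAQ.
Qed.

End MoorePenrose.

Lemma eigenvalue_le_spectral_radius (R : realType) (n : nat)
    (A : 'M[Cplx R]_n) (a : Cplx R) :
  eigenvalue A a -> complex.Re `|a| <= spectral_radius A.
Proof.
move=> Aa; apply: ub_le_sup; last by exists a.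
have [s sE] := closed_field_poly_normal (char_poly A).
exists (\sum_(b <- s) complex.Re `|b|) => _ [b Ab <-].
have bs : b \in s.
  move: Ab; rewrite /= eigenvalue_root_char sE.
  by rewrite (monicP (char_poly_monic A)) scale1r root_prod_XsubC.
rewrite (big_rem b bs) /= lerDl sumr_ge0 // => c _.
by have := normr_ge0 c; rewrite lecE => /andP[].
Qed.

(* Main.v *)
(* All the matrices Y considered here, the reduced solutions as well as U^+ V,
   satisfy U Y = V and vanish on N(U).  For two of them U (Y - Y') = 0, hence
   Y Y = Y Y', and so Y^(k+1) = Y Y'^k: the powers of one tend to 0 iff those
   of the other do.  If Y is a reduced solution then 1 - Y is invertible, because
   Y x = x forces T x = 0 with x in M; the iteration therefore has a fixed point
   S, and X^i - S = Y^i (X^0 - S), whose limit, if any, is fixed by Y and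
   hence 0.  Finally Y^k -> 0 iff rho(Y) < 1, by Cayley-Hamilton applied to the
   factors Y - b of the split characteristic polynomial, one at a time. *)
Require Import Defs.
From mathcomp Require Import all_boot all_order all_algebra.
From mathcomp Require Import all_classical all_reals all_analysis.
From mathcomp Require Import complex ring.

Import Order.TTheory GRing.Theory Num.Theory.
Import numFieldNormedType.Exports.
Local Open Scope classical_set_scope.
Local Open Scope ring_scope.

Set Implicit Arguments.
Unset Strict Implicit.
Unset Printing Implicit Defensive.

(** * Null sequences in normed spaces over the complex numbers *)

(** The value [e / 2] is the fixed point of [t |-> q * t + e / 2 * (1 - q)]. Once [d] stays below
    [e / 2 * (1 - q)], the excess of [y] over [e / 2] is therefore bounded by a geometric sequence
    of ratio [q]. *)
Lemma contraction_cvg0 (R : realType) (q : R) (y d : nat -> R) :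
  0 <= q < 1 -> (forall k, 0 <= y k) ->
  (forall k, y k.+1 <= q * y k + d k) ->
  d @ \oo --> 0 -> y @ \oo --> 0.
Proof.
move=> /andP[q0 q1] y0 yS d0; apply/cvgr0Pnorm_le => e e0.
have /cvgr0_norm_le/(_ (e / 2 * (1 - q))) := d0.
case=> [|N _ dN]; first by rewrite !mulr_gt0 ?invr_gt0 ?subr_gt0.
have yN k : y (k + N)%N <= q ^+ k * y N + e / 2.
  elim: k => [|k IH]; first by rewrite expr0 mul1r lerDl divr_ge0 // ltW.
  apply: (le_trans (yS _)).
  have -> : q ^+ k.+1 * y N + e / 2 =
      q * (q ^+ k * y N + e / 2) + e / 2 * (1 - q).
    by rewrite exprS; ring.
  apply: lerD; first exact: ler_wpM2l.
  by apply: (le_trans (ler_norm _)); apply: dN; rewrite /= leq_addl.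
have : q ^+ k * y N @[k --> \oo] --> 0.
  rewrite -(mul0r (y N)); apply: cvgMl.
  by apply: cvg_expr; rewrite ger0_norm.
move=> /cvgr0_norm_le/(_ (e / 2)).
case=> [|N' _ qN']; first by rewrite divr_gt0.
exists (N' + N)%N => // k /= Nk.
rewrite ger0_norm // -(subnK (leq_trans (leq_addl _ _) Nk)).
apply: (le_trans (yN _)); rewrite [leRHS]splitr lerD2r.
apply: (le_trans (ler_norm _)); apply: qN'.
by rewrite /= leq_subRL ?(leq_trans (leq_addl _ _) Nk) // addnC.
Qed.

Lemma Re_norm (R : realType) (V : normedModType (Cplx R)) (x : V) :
  `|x| = (complex.Re `|x|)%:C%C.
Proof. by rewrite RRe_real // normr_real. Qed.

(** Norms over [Cplx R] are elements of [Cplx R]; this passage to real sequences makes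
    [contraction_cvg0] applicable. *)
Lemma cvg0_Re_norm (R : realType) (V : normedModType (Cplx R)) (u : nat -> V) :
  u @ \oo --> 0 <-> complex.Re `|u k| @[k --> \oo] --> 0.
Proof.
have Re_ge0 k : 0 <= complex.Re `|u k|.
  by have := normr_ge0 (u k); rewrite lecE => /andP[].
split=> [/cvgr0Pnorm_lt u0|/cvgr0Pnorm_lt u0]; apply/cvgr0Pnorm_lt => e e0.
  have /u0 : (0 : Cplx R) < e%:C%C by rewrite ltcR.
  by apply: filterS => k; rewrite ger0_norm // [`|u k|]Re_norm ltcR.
(* A positive element of [Cplx R] is real, so its real part serves as the real threshold. *)
have eR : e = (complex.Re e)%:C%C by rewrite RRe_real // gtr0_real.
have /u0 : 0 < complex.Re e by move: e0; rewrite ltcE => /andP[].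
apply: filterS => k; rewrite ger0_norm // eR [`|u k|]Re_norm ltcR.
by rewrite RRe_real // gtr0_real.
Qed.

(** By the triangle inequality the norms of [u] satisfy the recursion of [contraction_cvg0], with
    [q] the modulus of [a]. *)
Lemma affine_cvg0 (R : realType) (V : normedModType (Cplx R)) (a : Cplx R)
    (u : nat -> V) :
  `|a| < 1 -> u k.+1 - a *: u k @[k --> \oo] --> 0 -> u @ \oo --> 0.
Proof.
move=> a1 /cvg0_Re_norm du; apply/cvg0_Re_norm.
apply: (@contraction_cvg0 _ (complex.Re `|a|) _ _ _ _ _ du).
- apply/andP; split; first by have := normr_ge0 a; rewrite lecE => /andP[].
  by move: a1; rewrite ltcE => /andP[].
- by move=> k; have := normr_ge0 (u k); rewrite lecE => /andP[].
- move=> k; rewrite -lecR rmorphD rmorphM /= -!Re_norm -normrZ.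
  by rewrite -{1}(subrKC (a *: u k) (u k.+1)) ler_normD.
Qed.

(** * Limits of matrix sequences *)

Lemma cvg_mxP (K : numFieldType) (m n : nat) (I : Type) (F : set_system I)
    {FF : Filter F} (u : I -> 'M[K]_(m, n)) (L : 'M[K]_(m, n)) :
  u @ F --> L <-> forall i j, u k i j @[k --> F] --> L i j.
Proof.
split=> [uL i j|uL].
  exact: (cvg_comp _ _ uL (@coord_continuous K m n i j L)).
(* A neighbourhood of [L] contains a box of entry neighbourhoods [P i j], and there are finitely
   many entries. *)
move=> A [P LP sPA]; apply: filterS (sPA) _.
apply: filter_forall => i; apply: filter_forall => j.
exact: (uL i j _ (LP i j)).
Qed.

Lemma cvg_mulmx (K : numFieldType) (m n r : nat) (I : Type)
    (F : set_system I) {FF : Filter F} (A : 'M[K]_(m, n))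
    (u : I -> 'M[K]_(n, r)) (L : 'M[K]_(n, r)) :
  u @ F --> L -> A *m u k @[k --> F] --> A *m L.
Proof.
move=> /cvg_mxP uL; apply/cvg_mxP => i j; rewrite mxE.
under eq_fun do rewrite mxE.
apply: cvg_big => [x|k _]; first exact: add_continuous.
by apply: cvgMr.
Qed.

(** * Powers of a matrix and its spectral radius *)

Lemma iter_mulmxBZ (K : fieldType) (n r : nat) (A : 'M[K]_n) (b : K)
    (B D : 'M[K]_(n, r)) k :
  iter k (mulmx A) (B - b *: D) =
  iter k (mulmx A) B - b *: iter k (mulmx A) D.
Proof. by elim: k => //= k ->; rewrite mulmxBr -scalemxAr. Qed.

(** Induction on [s]: the remaining factors annihilate [(A - b%:M) *m D], whose iterates are exactly
    the differences required by [affine_cvg0]. *)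
Lemma iter_mulmx_cvg0_annihilated (R : realType) (n r : nat)
    (A : 'M[Cplx R]_n.+1) (s : seq (Cplx R)) (D : 'M[Cplx R]_(n.+1, r)) :
  (forall b, b \in s -> `|b| < 1) ->
  (\prod_(b <- s) (A - b%:M)) *m D = 0 ->
  iter k (mulmx A) D @[k --> \oo] --> (0 : 'M[Cplx R]_(n.+1, r)).
Proof.
elim/last_ind: s D => [|s b IH] D s1.
  rewrite big_nil mul1mx => ->.
  rewrite [X in X @ _ --> _](_ : _ = cst 0); first exact: cvg_cst.
  by apply/funext; elim=> //= k ->; rewrite mulmx0.
rewrite big_rcons /= -mulmxA => annD.
apply: (@affine_cvg0 _ _ b (fun k => iter k (mulmx A) D)).
  by apply: s1; rewrite mem_rcons inE eqxx.
under eq_fun do rewrite iterSr -iter_mulmxBZ -mul_scalar_mx -mulmxBl.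
by apply: IH => // c cs; apply: s1; rewrite mem_rcons inE cs orbT.
Qed.

Lemma spectral_radius_lt1 (R : realType) (n : nat) (A : 'M[Cplx R]_n) :
  spectral_radius A < 1 <-> forall a, eigenvalue A a -> `|a| < 1.
Proof.
split=> [A1 a Aa|A1].
  rewrite (Re_norm (a : Cplx R)) ltcR.
  exact: le_lt_trans (eigenvalue_le_spectral_radius Aa) A1.
have [s sE] := closed_field_poly_normal (char_poly A).
have As a : eigenvalue A a = (a \in s).
  by rewrite eigenvalue_root_char sE (monicP (char_poly_monic A)) scale1r
             root_prod_XsubC.
rewrite /spectral_radius.
set S := (X in sup X).
(* Without eigenvalues, as when [n = 0], the supremum of the empty set is 0. *)
have [->|S0] := eqVneq S set0; first by rewrite sup0.
(* The eigenvalues are the finitely many elements of [s], so a maximum bounds the supremum and keeps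
   the inequality strict. *)
apply: (@le_lt_trans _ _ (\big[Num.max/0]_(a <- s) complex.Re `|a|)).
  apply: ge_sup; first exact/set0P.
  by move=> _ [a Aa <-]; apply: (bigmax_sup_seq _ a); rewrite -?As.
rewrite big_seq; elim/big_ind: _ => [|x y x1 y1|a]; rewrite ?gt_max ?x1 //.
by rewrite -As => /A1; rewrite ltcE => /andP[].
Qed.

(** With [r = 0] the left side would hold for every [A]; a single column is enough to detect an
    eigenvalue. *)
Lemma iter_mulmx_cvg0 (R : realType) (n r : nat) (A : 'M[Cplx R]_n) :
  (0 < r)%N ->
  (forall D : 'M[Cplx R]_(n, r),
     iter k (mulmx A) D @[k --> \oo] --> (0 : 'M[Cplx R]_(n, r))) <->
  spectral_radius A < 1.
Proof.
move=> r0; split=> [AD|/spectral_radius_lt1 A1].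
  apply/spectral_radius_lt1 => a /eigenvalueP[v vA v0].
  have /existsP[j vj] : [exists j, v 0 j != 0].
    apply: contraNT v0; rewrite negb_exists => /forallP v0.
    by apply/eqP/rowP => j; rewrite mxE; apply/eqP; have := v0 j; rewrite negbK.
  (* [eigenvalue] refers to row vectors, so [v] multiplies on the left; the only 1 of [D] picks out
     the nonzero entry [v 0 j]. *)
  pose D : 'M[Cplx R]_(n, r) := delta_mx j (Ordinal r0).
  have vAk k : v *m iter k (mulmx A) D = a ^+ k *: (v *m D).
    elim: k => [|k IH] /=; first by rewrite expr0 scale1r.
    by rewrite mulmxA vA -scalemxAl IH scalerA exprS.
  have vD : v *m D != 0.
    apply: contraNneq vj => /matrixP/(_ 0 (Ordinal r0)).
    rewrite !mxE (bigD1 j) //= mxE !eqxx mulr1 big1 ?addr0 => [->|k kj] //.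
    by rewrite mxE (negbTE kj) mulr0.
  have av0 : a ^+ k *: (v *m D) @[k --> \oo] --> (0 : 'M[Cplx R]_(1, r)).
    under eq_fun do rewrite -vAk.
    by rewrite -(mulmx0 _ v); apply: cvg_mulmx.
  (* Taking the norm of [v *m D] itself as tolerance yields one power of [a] of modulus below 1,
     which suffices. *)
  have /cvgr0Pnorm_lt/(_ `|v *m D|) := av0.
  rewrite normr_gt0 => /(_ vD)[k _].
  move=> /(_ k (leqnn k)) /=; rewrite normrZ normrX.
  rewrite -[ltRHS]mul1r ltr_pM2r ?normr_gt0 // => ak1.
  rewrite real_ltNge ?normr_real //.
  by apply: contraTN ak1 => a1; rewrite real_ltNge ?exprn_ege1 // normr_real.
case: n A A1 => [|n] A A1 D.
  rewrite [X in X @ _ --> _](_ : _ = cst 0); first exact: cvg_cst.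
  by apply/funext => k; exact: flatmx0.
have [s sE] := closed_field_poly_normal (char_poly A).
rewrite (monicP (char_poly_monic A)) scale1r in sE.
apply: (@iter_mulmx_cvg0_annihilated _ _ _ _ s).
  by move=> b bs; apply: A1; rewrite eigenvalue_root_char sE root_prod_XsubC.
have := Cayley_Hamilton A; rewrite sE rmorph_prod /=.
under eq_bigr do rewrite rmorphB /= horner_mx_X horner_mx_C.
by move=> ->; rewrite mul0mx.
Qed.

(** * Affine iterations *)

(** Square test matrices [x] allow the transpose of the whole kernel of [A^T] to be tested at
    once. *)
Lemma unitmx_inj (K : fieldType) (n : nat) (A : 'M[K]_n) :
  (forall x : 'M[K]_n, A *m x = 0 -> x = 0) -> A \in unitmx.
Proof.
move=> A0; rewrite -unitmx_tr -row_free_unit -kermx_eq0 -trmx_eq0.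
by apply/eqP/A0; rewrite -{1}[A]trmxK -trmx_mul mulmx_ker trmx0.
Qed.

Lemma cvgn_affine_iter (R : realType) (n r : nat) (Y : 'M[Cplx R]_n)
    (Z : 'M[Cplx R]_(n, r)) :
  1%:M - Y \in unitmx ->
  (forall X0 : 'M[Cplx R]_(n, r),
     cvgn (fun i => iter i (fun X => Y *m X + Z) X0)) <->
  (forall D : 'M[Cplx R]_(n, r),
     iter k (mulmx Y) D @[k --> \oo] --> (0 : 'M[Cplx R]_(n, r))).
Proof.
move=> Yu.
have [X XE] : exists X, X = Y *m X + Z.
  exists (invmx (1%:M - Y) *m Z); apply/eqP.
  by rewrite [_ + Z]addrC -subr_eq -{1}[_ *m Z]mul1mx -mulmxBl mulKVmx.
have iterE X0 i :
    iter i (fun X => Y *m X + Z) X0 = iter i (mulmx Y) (X0 - X) + X.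
  elim: i => [|i IH]; first by rewrite subrK.
  by rewrite /= IH mulmxDr -addrA -XE.
split=> [cvgX D|D0 X0]; last first.
  under eq_fun do rewrite iterE.
  by apply: is_cvgD; [apply/cvg_ex; exists 0 | apply: is_cvg_cst].
(* Starting the affine iteration at [D + X] makes its error exactly the iterates of [D]. *)
have [L DL] : exists L,
    iter k (mulmx Y) D @[k --> \oo] --> (L : 'M[Cplx R]_(n, r)).
  apply/cvg_ex; rewrite [X in X @ _](_ : _ = fun k =>
      iter k (fun X => Y *m X + Z) (D + X) - X).
    by apply: is_cvgB; [exact: cvgX | exact: is_cvg_cst].
  by apply/funext => k; rewrite iterE !addrK.
(* The shifted sequence has both [Y *m L] and [L] as limits. *)
have YL : Y *m L = L.
  have cvgYL :
      Y *m iter k (mulmx Y) D @[k --> \oo] --> (Y *m L : 'M[Cplx R]_(n, r)).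
    exact: cvg_mulmx.
  have cvgL : Y *m iter k (mulmx Y) D @[k --> \oo] --> (L : 'M[Cplx R]_(n, r)).
    by move: DL; rewrite -(cvg_shiftS (fun k => iter k (mulmx Y) D)).
  exact: (@norm_cvg_unique _ 'M[Cplx R]_(n, r) _ _ _ _ cvgYL cvgL).
suff L0 : L = 0 by rewrite L0 in DL.
by rewrite -(mulKmx Yu L) mulmxBl YL mul1mx subrr mulmx0.
Qed.

(** * Proper splittings and comparison of their iteration matrices *)

Lemma proper_splitting_range (C : fieldType) (m n : nat) (T U V : 'M[C]_(m, n)) :
  proper_splitting T U V -> (mxrange V <= mxrange U)%VS.
Proof.
move=> [TE UT _]; apply/subvP => _ /mxrangeP[x ->].
have -> : V *m x = U *m x - T *m x by rewrite TE mulmxBl subKr.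
by apply: rpredB; [|rewrite UT]; apply/mxrangeP; exists x.
Qed.

Lemma mulmx_null (C : fieldType) (m p n r : nat) (A : 'M[C]_(m, n))
    (B : 'M[C]_(p, n)) (X : 'M[C]_(n, r)) :
  mxnull A = mxnull B -> A *m X = 0 -> B *m X = 0.
Proof.
move=> AB AX; apply/matrixP => i j.
have : col j X \in mxnull A by rewrite mem_mxnull -colM AX col0.
by rewrite AB mem_mxnull -colM => /eqP/colP/(_ i); rewrite !mxE.
Qed.

(** Each column lies in both summands. This serves both to make a reduced solution vanish on N(U)
    and to invert [1%:M - Y]. *)
Lemma complementary_eq0 (C : fieldType) (m n r : nat) (U : 'M[C]_(m, n))
    (M : {vspace 'cV[C]_n}) (X : 'M[C]_(n, r)) :
  complementary M (mxnull U) -> U *m X = 0 -> (mxrange X <= M)%VS -> X = 0.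
Proof.
move=> [/directv_addP MN _] UX XM; apply/matrixP => i j.
have : col j X \in (M :&: mxnull U)%VS.
  rewrite memv_cap mem_mxnull -colM UX col0 eqxx andbT.
  by have /mxrange_sub := XM; apply.
by rewrite MN memv0 => /eqP/colP/(_ i); rewrite !mxE.
Qed.

(** One factor [Y] stays in front to absorb [Y - Y'], whose columns lie in N(U); hence the index
    [k.+1] on the left. *)
Lemma iter_mulmx_factor (K : fieldType) (m n r : nat) (U V : 'M[K]_(m, n))
    (Y Y' : 'M[K]_n) (D : 'M[K]_(n, r)) k :
  (forall X : 'M[K]_n, U *m X = 0 -> Y *m X = 0) ->
  U *m Y = V -> U *m Y' = V ->
  iter k.+1 (mulmx Y) D = Y *m iter k (mulmx Y') D.
Proof.
move=> Y0 UY UY'; elim: k => // k IH.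
have YY : Y *m Y = Y *m Y'.
  by apply/eqP; rewrite -subr_eq0 -mulmxBr Y0 // mulmxBr UY UY' subrr.
by rewrite iterS IH [in RHS]iterS !mulmxA YY.
Qed.

(** The first Penrose equation makes [A *m mp_inverse A] the identity on the range of [A]. *)
Lemma mulmx_mp_inverse (C : numClosedFieldType) (m n r : nat)
    (A : 'M[C]_(m, n)) (B : 'M[C]_(m, r)) :
  (mxrange B <= mxrange A)%VS -> A *m (mp_inverse A *m B) = B.
Proof.
move=> BA; have [APA _ _ _] := mp_inverseP A.
apply/matrixP => i j.
have /mxrangeP[x Bx] : col j B \in mxrange A by have /mxrange_sub := BA; apply.
have : col j (A *m (mp_inverse A *m B)) = col j B.
  by rewrite !colM Bx !mulmxA APA.
by move=> /colP/(_ i); rewrite !mxE.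
Qed.

Lemma iterates_cvgP (R : realType) (m n r : nat)
    (T U V : 'M[Cplx R]_(m, n)) (W : 'M[Cplx R]_(m, r))
    (M : {vspace 'cV[Cplx R]_n}) :
  (0 < r)%N -> proper_splitting T U V ->
  complementary M (mxnull T) ->
  (forall X0 : 'M[Cplx R]_(n, r), cvgn (iterates U V W M X0)) <->
  spectral_radius (mp_inverse U *m V) < 1.
Proof.
move=> r0 splT; have VU := proper_splitting_range splT.
have [TE _ UT] := splT; rewrite -UT => cM.
have VE : V = U - T by rewrite TE subKr.
have [UY YM] := reduced_solutionP VU cM.
set Y := reduced_solution M U V in UY YM.
have V0 (p : nat) (X : 'M[Cplx R]_(n, p)) : U *m X = 0 -> V *m X = 0.
  by move=> UX; rewrite VE mulmxBl UX (mulmx_null UT UX) subr0.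
have Yrange p (X : 'M[Cplx R]_(n, p)) : (mxrange (Y *m X) <= M)%VS.
  apply/mxrange_sub => j; rewrite colM.
  by apply: (subvP YM); apply/mxrangeP; exists (col j X).
have Y0 (X : 'M[Cplx R]_n) : U *m X = 0 -> Y *m X = 0.
  by move=> UX; apply: (complementary_eq0 cM); rewrite // mulmxA UY V0.
have Yu : 1%:M - Y \in unitmx.
  apply: unitmx_inj => X; rewrite mulmxBl mul1mx => /subr0_eq XE.
  apply: (complementary_eq0 cM); last by rewrite XE.
  apply: (mulmx_null (esym UT)).
  by rewrite TE mulmxBl {1}XE mulmxA UY subrr.
rewrite -(iter_mulmx_cvg0 _ r0).
apply: (iff_trans (cvgn_affine_iter (reduced_solution M U W) Yu)).
set Y' := mp_inverse U *m V.
have UY' : U *m Y' = V by exact: mulmx_mp_inverse.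
have Y'0 (X : 'M[Cplx R]_n) : U *m X = 0 -> Y' *m X = 0.
  by move=> UX; rewrite -mulmxA V0 // mulmx0.
(* Stated for arbitrary [Y1] and [Y2] so that it applies to [Y] and [Y'] in either order. *)
have transfer (Y1 Y2 : 'M[Cplx R]_n) :
    (forall X : 'M[Cplx R]_n, U *m X = 0 -> Y1 *m X = 0) ->
    U *m Y1 = V -> U *m Y2 = V ->
    (forall D : 'M[Cplx R]_(n, r),
       iter k (mulmx Y2) D @[k --> \oo] --> (0 : 'M[Cplx R]_(n, r))) ->
    (forall D : 'M[Cplx R]_(n, r),
       iter k (mulmx Y1) D @[k --> \oo] --> (0 : 'M[Cplx R]_(n, r))).
  move=> Y10 UY1 UY2 cvg2 D.
  rewrite -(cvg_shiftS (fun k => iter k (mulmx Y1) D)).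
  under eq_fun do rewrite (iter_mulmx_factor _ _ Y10 UY1 UY2).
  by rewrite -(mulmx0 _ Y1); apply: cvg_mulmx.
by split; apply: transfer.
Qed.

(** This provides an admissible [M], without which convergence for every [M] would not give
    convergence for some [M]. *)
Lemma complementary_compl (C : fieldType) (n : nat) (N : {vspace 'cV[C]_n}) :
  complementary (N^C)%VS N.
Proof.
split; last by rewrite addvC addv_complf.
by apply/directv_addP; rewrite capvC capv_compl.
Qed.

Theorem corollary5p3 (R : realType) (m n r : nat)
    (T U V : 'M[Cplx R]_(m, n)) (W : 'M[Cplx R]_(m, r)) :
  (0 < r)%N ->
  proper_splitting T U V ->
  (mxrange W <= mxrange T)%VS ->
  ((exists M : {vspace 'cV[Cplx R]_n}, complementary M (mxnull T) /\
      forall X0 : 'M[Cplx R]_(n, r), cvgn (iterates U V W M X0))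
   <->
   (forall M : {vspace 'cV[Cplx R]_n}, complementary M (mxnull T) ->
      forall X0 : 'M[Cplx R]_(n, r), cvgn (iterates U V W M X0)))
  /\
  (forall M : {vspace 'cV[Cplx R]_n}, complementary M (mxnull T) ->
     ((forall X0 : 'M[Cplx R]_(n, r), cvgn (iterates U V W M X0)) <->
      spectral_radius (mp_inverse U *m V) < 1)).
Proof.
move=> r0 splT _; have cvgP M := iterates_cvgP W (M := M) r0 splT.
split=> //; split=> [[M [cM cvgM]] M' cM'|cvgM].
  (* The spectral radius condition does not involve the complement, so it links [M] to [M']. *)
  by apply/(cvgP _ cM')/(cvgP _ cM).
have cN := complementary_compl (mxnull T).
by exists ((mxnull T)^C)%VS; split=> //; apply: cvgM.
Qed.
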